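(* For every integer $r\ge 4$, $$\frac{3r-4}{3r-1}<\delta_r\le\frac{4(3r-7)(r-1)+1}{4(r-2)(3r-4)}.$$
   Context: All graphs are finite and simple. For a graph $G$, $P_{k}(G)$ denotes the largest number of edges in a $k$-partite subgraph of $G$, and $K_rf(G)$ denotes the largest number of edges in a $K_r$-free subgraph of $G$ ($r\ge 3$). Always $P_{r-1}(G)\le K_rf(G)$. The number $\delta_r$ is the least number (understood as the infimum of all real numbers $c$) such that, for all sufficiently large $n$, every graph $G$ on $n$ vertices with minimum degree $\delta(G)\ge c\,n$ satisfies $P_{r-1}(G)=K_rf(G)$. *)

(* Defs.v *)
From mathcomp Require Import all_boot all_order all_algebra.
From mathcomp Require Import classical_sets reals.

Set Implicit Arguments.
Unset Strict Implicit.
Unset Printing Implicit Defensive.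

Import Order.TTheory GRing.Theory Num.Theory.

(* A graph on the vertex set T is given by its set of edges, each edge being
   the set of its two end vertices. *)
Definition simple_graph (T : finType) (E : {set {set T}}) : bool :=
  [forall e in E, #|e| == 2].

Definition adjacent (T : finType) (E : {set {set T}}) (x y : T) : bool :=
  [set x; y] \in E.

Definition degree (T : finType) (E : {set {set T}}) (x : T) : nat :=
  #|[pred y | adjacent E x y]|.

(* Every degree of a simple graph is below #|T|, so the default value #|T| of
   the iterated minimum plays no role unless T is empty. *)
Definition min_degree (T : finType) (E : {set {set T}}) : nat :=
  \big[minn/#|T|]_(x : T) degree E x.

(* The k vertex classes are the fibres of a map to 'I_k; they may be empty. *)
Definition kpartite (T : finType) (k : nat) (E : {set {set T}}) : bool :=
  [exists f : {ffun T -> 'I_k},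
    [forall x, forall y, adjacent E x y ==> (f x != f y)]].

Definition clique (T : finType) (E : {set {set T}}) (A : {set T}) : bool :=
  [forall x in A, forall y in A, (x != y) ==> adjacent E x y].

Definition Kr_free (T : finType) (r : nat) (E : {set {set T}}) : bool :=
  ~~ [exists A : {set T}, (#|A| == r) && clique E A].

(* In both maxima H ranges over the spanning subgraphs only: adding isolated
   vertices to a subgraph affects neither its number of edges nor, for k >= 1
   and r >= 2, its being k-partite or K_r-free. *)
Definition max_kpartite (T : finType) (k : nat) (E : {set {set T}}) : nat :=
  \max_(H : {set {set T}} | (H \subset E) && kpartite k H) #|H|.

Definition max_Kr_free (T : finType) (r : nat) (E : {set {set T}}) : nat :=
  \max_(H : {set {set T}} | (H \subset E) && Kr_free r H) #|H|.

Local Open Scope ring_scope.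

Definition forces_equality (R : realType) (r : nat) (c : R) : Prop :=
  exists n0 : nat, forall n : nat, (n0 <= n)%N ->
  forall (T : finType) (E : {set {set T}}), #|T| = n -> simple_graph E ->
    c * n%:R <= (min_degree E)%:R ->
    max_kpartite r.-1 E = max_Kr_free r E.

(* For r >= 3 the set is nonempty (it contains every c >= 1) and bounded below
   (it contains no c <= 0), so that inf is the actual infimum and not its
   default value 0. *)
Definition delta (R : realType) (r : nat) : R :=
  inf [set c : R | forces_equality r c]%classic.

(* Main.v *)
Require Import Defs.
From mathcomp Require Import classical_sets reals.
From mathcomp Require Import all_boot all_order all_algebra.
From mathcomp Require Import zify ring lra.

(** Why the theorem is true.

    Upper bound.  Put k = r - 1, q = r - 2, let G have minimum degree d and let
    H be a K_r-free subgraph of G with the most edges.  Putting the vertices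
    one after another into the best of k classes keeps the fraction b = (k-1)/k
    of all edges, so e(H) >= b e(G).  The Andrasfai-Erdos-Sos theorem says that
    a K_r-free graph on m vertices with all degrees above a m, where
    a = (3r-7)/(3r-4), is k-partite.  Delete from H, as long as possible, a
    vertex whose degree in the current set of m vertices is at most a m.  What
    is left is k-partite, on m0 vertices, hence has at most b m0^2 / 2 edges;
    against e(H) >= b d n / 2 this forces m0 >= n/2 as soon as
    b d >= (a + (b-a)/4) n, up to lower order terms.  Now put the deleted
    vertices back in reverse order, each time into the best class with respect
    to all edges of G.  Its gain is at least b (d - n + m), its loss was at
    most a m; over the at most n/2 deleted vertices the gains prevail, again
    because of that condition on d.  Thus a k-partite subgraph of G has at
    least e(H) edges.  Since b - a = 1/((r-1)(3r-4)), the condition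
    d/n > (a + (b-a)/4)/b is exactly the stated bound.  This is
    [coloring_beats_clique_free].

    The Andrasfai-Erdos-Sos theorem is proved along the lines of Brandt.  In an
    edge-maximal K_r-free graph in which non-adjacency is not an equivalence
    relation there is a wheel-like configuration made of a 5-cycle and two
    cliques s and t.  Counting non-neighbours on one in which s and t share as
    many vertices as possible produces a vertex of small degree.

    Lower bound.  It suffices to have one vertex-weighted graph G, with a
    K_r-free subgraph H heavier than every (r-1)-partite subgraph of G, in
    which the non-neighbours of any vertex (itself included) weigh at most s
    while the total weight N satisfies 3N > (3r-1)s: its blow-ups are
    unweighted counterexamples of minimum degree (1 - s/N) n on arbitrarily
    many vertices ([gap_graphs]).  For r = 3 such a graph has nine vertices,
    s = 37 and N = 99 ([base_separating]).  Joining a vertex of weight s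
    increases r by one, N by s, and preserves the other properties
    ([separating_join]). *)

Set Implicit Arguments.
Unset Strict Implicit.
Unset Printing Implicit Defensive.

Import Order.TTheory GRing.Theory Num.Theory.

(** * Cliques and edge-maximal clique-free graphs *)

Definition is_clique (T : finType) (e : rel T) (A : {set T}) : bool :=
  [forall x in A, forall y in A, (x != y) ==> e x y].

Definition clique_free (T : finType) (r : nat) (e : rel T) : Prop :=
  forall A : {set T}, is_clique e A -> #|A| < r.

Lemma is_cliqueP (T : finType) (e : rel T) (A : {set T}) :
  reflect {in A &, forall x y, x != y -> e x y} (is_clique e A).
Proof.
apply: (iffP forall_inP) => [h x y xA yA xy|h x xA].
  by move/forall_inP: (h x xA) => /(_ y yA) /implyP/(_ xy).
by apply/forall_inP => y yA; apply/implyP; exact: h.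
Qed.

Lemma sub_clique (T : finType) (e : rel T) (A B : {set T}) :
  B \subset A -> is_clique e A -> is_clique e B.
Proof.
move=> /subsetP BA /is_cliqueP h; apply/is_cliqueP => x y xB yB.
by apply: h; apply: BA.
Qed.

Lemma clique_setU1 (T : finType) (e : rel T) (x : T) (A : {set T}) :
  symmetric e -> {in A, forall y, e x y} -> is_clique e A ->
  is_clique e (x |: A).
Proof.
move=> es ex /is_cliqueP h; apply/is_cliqueP => a b.
rewrite !inE => /predU1P[->|aA] /predU1P[->|bA] ab.
- by rewrite eqxx in ab.
- exact: ex.
- by rewrite es; exact: ex.
- exact: h.
Qed.

Lemma subset_of_card (T : finType) (A : {set T}) (n : nat) :
  n <= #|A| -> exists2 B : {set T}, B \subset A & #|B| = n.
Proof.
move=> nA; exists [set x in take n (enum A)].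
  by apply/subsetP => x; rewrite inE => /mem_take; rewrite mem_enum.
rewrite cardsE (card_uniqP _); first by rewrite size_takel // -cardE.
exact: take_uniq (enum_uniq _).
Qed.

Lemma three_of_set (T : finType) (A : {set T}) (a b c : T) :
  a \in A -> b \in A -> c \in A -> a != b -> a != c -> b != c -> 3 <= #|A|.
Proof.
move=> aA bA cA ab ac bc.
rewrite cardE; apply: (@uniq_leq_size _ [:: a; b; c]).
  by rewrite /= !inE negb_or ab ac bc.
by move=> x; rewrite !inE mem_enum => /or3P[] /eqP->.
Qed.

(** In an edge-maximal K_(q+2)-free graph, joining two non-adjacent vertices
    creates a K_(q+2), which must use the new edge: the remaining q vertices
    form a clique in the common neighbourhood of the two. *)
Lemma edge_maximal_supergraph (T : finType) (q : nat) (e : rel T) :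
    symmetric e -> irreflexive e -> clique_free q.+2 e ->
  exists2 e' : rel T,
    [/\ symmetric e', irreflexive e', clique_free q.+2 e' & subrel e e']
  & forall a b, a != b -> ~~ e' a b ->
    exists s : {set T}, [/\ #|s| = q, is_clique e' s &
      {in s, forall y, e' a y && e' b y}].
Proof.
move=> es ei ef.
pose R (D : {set T * T}) : rel T := fun x y => (x, y) \in D.
pose P (D : {set T * T}) := [&& [forall x, forall y, R D x y == R D y x],
  [forall x, ~~ R D x x] & [forall A : {set T}, is_clique (R D) A ==> (#|A| < q.+2)]].
have PP D : reflect [/\ symmetric (R D), irreflexive (R D) & clique_free q.+2 (R D)] (P D).
  apply: (iffP and3P) => [[h1 h2 h3]|[h1 h2 h3]]; split.
  - by move=> x y; apply/eqP; move/forallP: h1 => /(_ x)/forallP.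
  - by move=> x; apply/negbTE; move/forallP: h2.
  - by move=> A; move/forallP: h3 => /(_ A)/implyP.
  - by apply/forallP=> x; apply/forallP => y; rewrite h1.
  - by apply/forallP=> x; rewrite h2.
  - by apply/forallP=> A; apply/implyP; exact: h3.
pose D0 := [set p : T * T | e p.1 p.2].
have RD0 : R D0 =2 e by move=> x y; rewrite /R inE.
have PD0 : P D0.
  apply/PP; split; [by move=> x y; rewrite !RD0|by move=> x; rewrite RD0|].
  move=> A /is_cliqueP hA; apply: ef; apply/is_cliqueP => x y xA yA xy.
  by rewrite -RD0; exact: hA.
have [D Dmax D0D] := maxset_exists PD0.
have /PP[Ds Di Df] := maxsetp Dmax.
exists (R D).
  by split=> // x y; rewrite -RD0; exact: (subsetP D0D).
move=> a b ab Nab.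
pose D' := (a, b) |: ((b, a) |: D).
have RD' x y : R D' x y =
    [|| (x == a) && (y == b), (x == b) && (y == a) | R D x y].
  by rewrite /R !inE !xpair_eqE.
have NPD' : ~~ P D'.
  apply/negP => PD'.
  have DD' : D \subset D' by rewrite /D' setUA subsetUr.
  have := maxsetsup Dmax PD' DD' => D'D.
  by move: Nab; rewrite /R -D'D !inE eqxx.
have D's : symmetric (R D').
  by move=> x y; rewrite !RD' Ds; do 4 case: eqP => //=.
have D'i : irreflexive (R D').
  move=> x; rewrite RD' Di orbF; apply/negP.
  by case/orP => /andP[/eqP-> /eqP ab']; rewrite ab' eqxx in ab.
have [A Acl Ac] : exists2 A : {set T}, is_clique (R D') A & q.+2 <= #|A|.
  apply/exists_inP; rewrite -[X in is_true X]negbK negb_exists_in.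
  apply: contra NPD' => /forall_inP h; apply/PP; split=> // A /h.
  by rewrite -ltnNge.
have inA u : u \in [set a; b] -> ~~ (u \notin A).
  move=> uab; apply/negP => uA; have := Df A; rewrite ltnNge Ac => Df'.
  suff /Df' : is_clique (R D) A by [].
  apply/is_cliqueP => x y xA yA xy.
  move/is_cliqueP: Acl => /(_ x y xA yA xy); rewrite RD'.
  case/or3P => // /andP[/eqP xE /eqP yE]; move: uab uA;
    by rewrite !inE => /orP[] /eqP->; rewrite -?xE -?yE ?xA ?yA.
have aA : a \in A by apply/negPn/inA => //; rewrite !inE eqxx.
have bA : b \in A by apply/negPn/inA => //; rewrite !inE eqxx orbT.
have [s sA sq] : exists2 s : {set T}, s \subset A :\ a :\ b & #|s| = q.
  apply: subset_of_card.
  have := cardsD1 a A; have := cardsD1 b (A :\ a).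
  by rewrite !inE aA bA eq_sym ab /=; lia.
have sP y : y \in s -> [/\ y != a, y != b & y \in A].
  by move/(subsetP sA); rewrite !inE => /and3P[].
exists s; split=> //.
  apply/is_cliqueP => x y xs ys xy.
  have [xa xb xA] := sP _ xs; have [ya yb yA] := sP _ ys.
  move/is_cliqueP: Acl => /(_ x y xA yA xy); rewrite RD'.
  by rewrite (negbTE xa) (negbTE xb).
move=> y /sP[ya yb yA].
move/is_cliqueP: Acl => Acl.
have := Acl a y aA yA; have := Acl b y bA yA.
rewrite ![_ == y]eq_sym ya yb !RD' (negbTE ya) (negbTE yb) !andbF /=.
by move=> -> // ->.
Qed.

(** * The Andrasfai-Erdos-Sos theorem *)

(** A vertex is a non-neighbour of itself, so that this is the order of the
    graph minus the degree. *)
Definition nonnbr (T : finType) (e : rel T) (x : T) : nat :=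
  #|[set y | ~~ e x y]|.

(** For q = 1 and k = 0 this is a 5-cycle v s w1 w2 t; in general s and t are
    q-cliques that share k vertices. *)
Definition wheel (T : finType) (e : rel T) (q k : nat) : Prop :=
  exists v w1 w2 : T, exists s t : {set T},
  [/\ [/\ e w1 w2, ~~ e v w1 & ~~ e v w2],
      [/\ #|s| = q, is_clique e s & {in s, forall y, e v y && e w1 y}],
      [/\ #|t| = q, is_clique e t & {in t, forall y, e v y && e w2 y}]
    & #|s :&: t| = k].

Lemma sum_nonnbr_in (T : finType) (e : rel T) (A : {set T}) :
  symmetric e ->
  \sum_x #|[set w in A | ~~ e x w]| = \sum_(w in A) nonnbr e w.
Proof.
move=> es.
transitivity (\sum_x \sum_(w in A) (~~ e x w : nat)).
  apply: eq_bigr => x _; rewrite -sum1_card [RHS]big_mkcond /= big_mkcond /=.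
  by apply: eq_bigr => w _; rewrite inE; case: (w \in A); case: (e x w).
rewrite exchange_big; apply: eq_bigr => w _.
rewrite /nonnbr -sum1_card [RHS]big_mkcond; apply: eq_bigr => x _.
by rewrite inE es; case: (e w x).
Qed.

(** Let W be the vertex set of the wheel.  If every vertex adjacent to all of
    s :&: t had three non-neighbours in W, then counting non-adjacent pairs
    between the graph and W, with s :&: t counted three times, would give some
    vertex at least 3 #|T| / (3 q + 2) non-neighbours.  So some x is adjacent to
    s :&: t and has at most two non-neighbours in W.  None of the (q+1)-cliques
    v + s, w1 + s, v + t, w2 + t extends by x, which forces the two
    non-neighbours to be some a in s and some b in t; exchanging both for x
    makes s and t share one more vertex. *)
Lemma wheel_step (T : finType) (e : rel T) (q k : nat) :
    symmetric e -> irreflexive e -> clique_free q.+2 e ->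
    (forall x, (3 * q + 2) * nonnbr e x < 3 * #|T|) ->
  wheel e q k -> k < q /\ wheel e q k.+1.
Proof.
move=> es ei ef nd.
move=> [v [w1 [w2 [s [t [[w12 vw1 vw2] [sq sc sa] [tq tc ta] stk]]]]]].
have notin u (A : {set T}) : {in A, forall y, e u y} -> u \notin A.
  by move=> h; apply/negP => /h; rewrite ei.
have avs : {in s, forall y, e v y} by move=> y /sa/andP[].
have avt : {in t, forall y, e v y} by move=> y /ta/andP[].
have aw1 : {in s, forall y, e w1 y} by move=> y /sa/andP[].
have aw2 : {in t, forall y, e w2 y} by move=> y /ta/andP[].
have [w1t w2s] : w1 \notin t /\ w2 \notin s.
  by split; apply/negP; [move/avt; rewrite (negbTE vw1)|
    move/avs; rewrite (negbTE vw2)].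
have nvw1 : v != w1 by apply: contraNneq vw2 => ->.
have nvw2 : v != w2 by apply: contraNneq vw1 => ->; rewrite es.
have nw12 : w1 != w2 by apply/eqP => E; rewrite E ei in w12.
have kq : k < q.
  rewrite ltn_neqAle -{2}sq -stk subset_leq_card ?subsetIl // andbT.
  apply/eqP => stq.
  have st : s = t.
    have Es : s :&: t = s by apply/eqP; rewrite eqEcard subsetIl stq sq /=.
    have Et : s :&: t = t by apply/eqP; rewrite eqEcard subsetIr stq tq /=.
    by rewrite -Es {1}Et.
  have /ef : is_clique e (w1 |: (w2 |: s)).
    apply: clique_setU1 => //; last first.
      by apply: clique_setU1 => //; rewrite st.
    by move=> y; rewrite !inE => /predU1P[->|/aw1].
  by rewrite !cardsU1 !inE negb_or nw12 w2s notin // sq ltnn.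
split=> //.
pose W := v |: (w1 |: (w2 |: (s :|: t))).
pose N x := [set w in W | ~~ e x w].
(* Counting non-adjacent pairs: a vertex that misses a point of s :&: t is
   counted at least once in W and twice in s :&: t. *)
have [x xst Nx] : exists2 x, {in s :&: t, forall y, e x y} & #|N x| <= 2.
  suff : [exists x, [forall y in s :&: t, e x y] && (#|N x| <= 2)].
    by move=> /existsP[x /andP[/forall_inP h1 h2]]; exists x.
  rewrite -[X in is_true X]negbK; apply/negP => /existsPn h.
  have cnt x : 3 <= #|N x| + 2 * #|[set y in s :&: t | ~~ e x y]|.
    have := h x; rewrite negb_and -ltnNge => /orP[|]; last by clear; lia.
    rewrite negb_forall_in => /exists_inP[y yst Nxy].
    have h1 : 0 < #|N x|.
      apply/card_gt0P; exists y; move: yst; rewrite !inE => /andP[-> ->].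
      by rewrite Nxy !orbT.
    have h2 : 0 < #|[set y in s :&: t | ~~ e x y]|.
      by apply/card_gt0P; exists y; rewrite inE yst.
    by move: h1 h2; clear; lia.
  have Wk : #|W| + 2 * #|s :&: t| <= 3 * q + 2.
    have hW : #|W| <= 3 + #|s :|: t|.
      have hU u (A : {set T}) : #|u |: A| <= #|A|.+1.
        by rewrite cardsU1; case: (_ \notin _).
      by do 3 (apply: leq_trans (hU _ _) _; rewrite ltnS).
    move: (cardsUI s t) hW kq; rewrite sq tq stk; clear.
    by move: #|s :|: t| #|W| => *; lia.
  have sumnd (A : {set T}) :
      (3 * q + 2) * \sum_(w in A) nonnbr e w <= #|A| * (3 * #|T| - 1).
    rewrite big_distrr /= -sum_nat_const; apply: leq_sum => w _.
    by have := nd w; case: (3 * #|T|) => // m; rewrite ltnS subn1.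
  have : \sum_(x : T) 3 <= \sum_x (#|N x| + 2 * #|[set y in s :&: t | ~~ e x y]|).
    by apply: leq_sum.
  rewrite sum_nat_const cardT -cardT big_split /= -big_distrr /= !sum_nonnbr_in //.
  have T0 : 0 < #|T| by apply/card_gt0P; exists v.
  have := sumnd W; have := sumnd (s :&: t).
  move: (\sum_(w in W) _) (\sum_(w in s :&: t) _) => a b.
  move: Wk T0; move: #|T| #|W| #|s :&: t| => nT nW nst; clear => Wk T0 h1 h2 h3.
  have : (3 * q + 2) * (nT * 3) <= (nW + 2 * nst) * (3 * nT - 1).
    by apply: leq_trans (_ : (3 * q + 2) * (a + 2 * b) <= _); [rewrite leq_mul2l h3 orbT|lia].
  have : (nW + 2 * nst) * (3 * nT - 1) <= (3 * q + 2) * (3 * nT - 1).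
    by rewrite leq_mul2r Wk orbT.
  by nia.
have NP w : w \in W -> ~~ e x w -> w \in N x by move=> wW xw; rewrite inE wW.
have miss u (A : {set T}) : #|A| = q -> is_clique e A ->
    {in A, forall y, e u y} -> e x u -> exists2 y, y \in A & ~~ e x y.
  move=> Aq Ac uA xu; apply/exists_inP; rewrite -negb_forall_in; apply/negP.
  move=> /forall_inP xA.
  have /ef : is_clique e (x |: (u |: A)).
    apply: clique_setU1 => //; last exact: clique_setU1.
    by move=> y; rewrite !inE => /predU1P[->|/xA].
  rewrite !cardsU1 !inE negb_or !notin // Aq.
  by case: eqP => [xu'|]; [rewrite xu' ei in xu|rewrite ltnn].
have sW y : y \in s -> y \in W by move=> ys; rewrite !inE ys !orbT.
have tW y : y \in t -> y \in W by move=> yt; rewrite !inE yt !orbT.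
have vW : v \in W by rewrite !inE eqxx.
have w1W : w1 \in W by rewrite !inE eqxx !orbT.
have w2W : w2 \in W by rewrite !inE eqxx !orbT.
have three a b c : a \in W -> b \in W -> c \in W -> a != b -> a != c ->
    b != c -> ~~ e x a -> ~~ e x b -> e x c.
  move=> aW bW cW ab ac bc xa xb; apply/negPn/negP => xc.
  have := three_of_set (NP a aW xa) (NP b bW xb) (NP c cW xc) ab ac bc.
  by rewrite ltnNge Nx.
have stx y : y \in s -> y \in t -> e x y by move=> ys yt; apply: xst; rewrite inE ys.
have ns u y : {in s, forall y, e v y} -> ~~ e v u -> y \in s -> u != y.
  by move=> h vu ys; apply: contraNneq vu => ->; exact: h.
have nt u y : ~~ e v u -> y \in t -> u != y.
  by move=> vu yt; apply: contraNneq vu => ->; exact: avt.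
(* If x missed v, two further and distinct non-neighbours would be needed to
   stop x from extending w1 + s and w2 + t. *)
have xv : e x v.
  apply/negPn/negP => xv.
  have [a aW [xa av ac]] : exists2 a, a \in W &
      [/\ ~~ e x a, v != a & (a == w1) || (a \in s)].
    have [xw|xw] := boolP (e x w1); last by exists w1; rewrite // eqxx.
    have [a as' xa] := miss _ _ sq sc aw1 xw.
    by exists a; rewrite ?sW ?as' ?orbT //; split=> //; apply: ns => //; rewrite ei.
  have [b bW [xb bv bc]] : exists2 b, b \in W &
      [/\ ~~ e x b, v != b & (b == w2) || (b \in t)].
    have [xw|xw] := boolP (e x w2); last by exists w2; rewrite // eqxx.
    have [b bt xb] := miss _ _ tq tc aw2 xw.
    by exists b; rewrite ?tW ?bt ?orbT //; split=> //; apply: nt => //; rewrite ei.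
  have nab : a != b.
    apply/eqP => ab; rewrite -{}ab {bW xb bv} in bc.
    case/predU1P: ac => [Ea|as']; case/predU1P: bc => [Eb|bt].
    - by rewrite -Ea -Eb eqxx in nw12.
    - by rewrite -Ea bt in w1t.
    - by rewrite -Eb as' in w2s.
    - by rewrite stx in xa.
  by have := three v a b vW aW bW av bv nab xv xa; rewrite (negbTE xb).
have [a as' xa] := miss _ _ sq sc avs xv.
have [b bt xb] := miss _ _ tq tc avt xv.
have nat' : a \notin t by apply/negP => at'; rewrite stx in xa.
have nbs : b \notin s by apply/negP => bs; rewrite stx in xb.
have nab : a != b by apply: contraNneq nat' => ->.
have xW c : c \in W -> a != c -> b != c -> e x c.
  by move=> cW ac bc; apply: (three a b c) => //; auto.
have xw1 : e x w1.
  by apply: xW => //; rewrite eq_sym; [apply: ns|apply: nt].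
have xw2 : e x w2.
  by apply: xW => //; rewrite eq_sym; [apply: ns|apply: nt].
have xsa : {in s :\ a, forall y, e x y}.
  move=> y; rewrite !inE => /andP[ya ys]; apply: xW; rewrite ?sW // eq_sym //.
  by apply: contraNneq nbs => <-.
have xtb : {in t :\ b, forall y, e x y}.
  move=> y; rewrite !inE => /andP[yb yt]; apply: xW; rewrite ?tW // eq_sym //.
  by apply: contraNneq nat' => <-.
exists v, w1, w2, (x |: s :\ a), (x |: t :\ b); split.
- by split.
- split.
  + by rewrite cardsU1 notin // add1n; move: sq; rewrite (cardsD1 a s) as'.
  + by apply: clique_setU1 => //; apply: sub_clique sc; rewrite subsetDl.
  + move=> y; rewrite !inE => /predU1P[->|/andP[_ /sa]//].
    by rewrite ![e _ x]es xv xw1.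
- split.
  + by rewrite cardsU1 notin // add1n; move: tq; rewrite (cardsD1 b t) bt.
  + by apply: clique_setU1 => //; apply: sub_clique tc; rewrite subsetDl.
  + move=> y; rewrite !inE => /predU1P[->|/andP[_ /ta]//].
    by rewrite ![e _ x]es xv xw2.
- have -> : (x |: s :\ a) :&: (x |: t :\ b) = x |: (s :&: t).
    apply/setP => y; rewrite !inE; case: (y == x) => //=.
    have [->|_] := eqVneq y a; first by rewrite (negbTE nat') !andbF.
    by have [->|_] := eqVneq y b; first by rewrite (negbTE nbs) !andbF.
  by rewrite cardsU1 notin // stk.
Qed.

Lemma no_wheel (T : finType) (e : rel T) (q k : nat) :
    symmetric e -> irreflexive e -> clique_free q.+2 e ->
    (forall x, (3 * q + 2) * nonnbr e x < 3 * #|T|) ->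
  ~ wheel e q k.
Proof.
move=> es ei ef nd h.
have hk n : wheel e q (k + n).
  by elim: n => [|n IH]; rewrite ?addn0 // addnS; case: (wheel_step es ei ef nd IH).
by have [] := wheel_step es ei ef nd (hk q); lia.
Qed.

(** Stated through non-degrees, the condition is that all degrees exceed
    (3 q - 1) / (3 q + 2) times the order.  It passes to an edge-maximal
    supergraph; there the absence of wheels makes non-adjacency transitive, so
    the supergraph is complete multipartite, and a transversal of the parts is
    a clique, which bounds their number by q + 1. *)
Theorem Andrasfai_Erdos_Sos (T : finType) (e : rel T) (q : nat) :
    symmetric e -> irreflexive e -> clique_free q.+2 e ->
    (forall x, (3 * q + 2) * nonnbr e x < 3 * #|T|) ->
  exists f : T -> 'I_q.+1, forall x y, e x y -> f x != f y.
Proof.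
move=> es ei ef nd.
have [e' [es' ei' ef' ee'] emax] := edge_maximal_supergraph es ei ef.
have nd' x : (3 * q + 2) * nonnbr e' x < 3 * #|T|.
  apply: leq_ltn_trans (nd x); rewrite leq_mul2l; apply/orP; right.
  by apply/subset_leq_card/subsetP => y; rewrite !inE; apply/contra/ee'.
have ntrans v w1 w2 : ~~ e' v w1 -> ~~ e' v w2 -> ~~ e' w1 w2.
  move=> vw1 vw2; apply/negP => w12.
  have nv1 : v != w1 by apply: contraNneq vw2 => ->.
  have nv2 : v != w2 by apply: contraNneq vw1 => ->; rewrite es'.
  have [s [s1 s2 s3]] := emax _ _ nv1 vw1.
  have [t [t1 t2 t3]] := emax _ _ nv2 vw2.
  apply: (@no_wheel _ e' q #|s :&: t| es' ei' ef' nd').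
  by exists v, w1, w2, s, t.
pose rep x := odflt x [pick y | ~~ e' x y].
have repP x : ~~ e' x (rep x).
  by rewrite /rep; case: pickP => //= /(_ x); rewrite ei'.
have rep_eq x y : ~~ e' x y -> rep x = rep y.
  move=> xy; rewrite /rep.
  have -> : [pick z | ~~ e' x z] = [pick z | ~~ e' y z].
    apply: eq_pick => z; apply/idP/idP => h; first exact: ntrans xy h.
    by apply: ntrans h; rewrite es'.
  by case: pickP => //= /(_ y); rewrite ei'.
pose Q := [set rep x | x : T].
have Qc : is_clique e' Q.
  apply/is_cliqueP => _ _ /imsetP[x _ ->] /imsetP[y _ ->].
  apply: contraNT => h; apply/eqP/rep_eq.
  apply: (ntrans (rep x)); first by rewrite es' repP.
  by rewrite es'; apply: (ntrans (rep y)); [rewrite es' repP|rewrite es'].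
have Qq := ef' _ Qc.
pose g x := index (rep x) (enum Q).
have gQ x : g x < size (enum Q) by rewrite index_mem mem_enum imset_f.
exists (fun x => inord (g x)) => x y xy; apply/eqP => /(congr1 val) /=.
have gq z : g z < q.+1 by apply: leq_trans (gQ z) _; rewrite -cardE.
rewrite !inordK // => gxy.
have rxy : rep x = rep y.
  by rewrite -(nth_index x (_ : rep x \in enum Q)) -/(g x) ?gxy ?nth_index // mem_enum imset_f.
have : ~~ e' x y.
  apply: (ntrans (rep x)); first by rewrite es' repP.
  by rewrite rxy es' repP.
by rewrite ee'.
Qed.

(** * Peeling a clique-free graph and recolouring *)

Definition degree_in (T : finType) (e : rel T) (S : {set T}) (x : T) : nat :=
  \sum_(y in S) e x y.

(** Twice the number of edges inside S. *)
Definition arcs (T : finType) (e : rel T) (S : {set T}) : nat :=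
  \sum_(x in S) degree_in e S x.

Definition cut (T : finType) (k : nat) (e : rel T) (f : T -> 'I_k) : rel T :=
  fun x y => e x y && (f x != f y).

Lemma cut_sym (T : finType) (k : nat) (e : rel T) (f : T -> 'I_k) :
  symmetric e -> symmetric (cut e f).
Proof. by move=> es x y; rewrite /cut es eq_sym. Qed.

Lemma cut_irr (T : finType) (k : nat) (e : rel T) (f : T -> 'I_k) :
  irreflexive (cut e f).
Proof. by move=> x; rewrite /cut eqxx andbF. Qed.

Lemma eq_arcs (T : finType) (e e' : rel T) (S : {set T}) :
  {in S &, e =2 e'} -> arcs e S = arcs e' S.
Proof.
by move=> ee'; apply: eq_bigr => x xS; apply: eq_bigr => y yS; rewrite ee'.
Qed.

Lemma sub_arcs (T : finType) (e e' : rel T) (S : {set T}) :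
  {in S &, subrel e e'} -> arcs e S <= arcs e' S.
Proof.
move=> ee'; apply: leq_sum => x xS; apply: leq_sum => y yS.
by case exy: (e x y) => //; rewrite (ee' x y xS yS exy).
Qed.

Lemma arcsU1 (T : finType) (e : rel T) (S : {set T}) (x : T) :
  symmetric e -> irreflexive e -> x \notin S ->
  arcs e (x |: S) = arcs e S + 2 * degree_in e S x.
Proof.
move=> es ei xS.
have dU y : degree_in e (x |: S) y = e x y + degree_in e S y.
  by rewrite /degree_in big_setU1 //= es.
rewrite /arcs big_setU1 //= dU ei (eq_bigr _ (fun y _ => dU y)) big_split /=.
by rewrite mul2n -addnn add0n addnA addnC.
Qed.

Lemma exists_le_average (k : nat) (F : 'I_k.+1 -> nat) :
  exists c, k.+1 * F c <= \sum_c F c.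
Proof.
pose c := [arg min_(c < ord0) F c]; exists c.
rewrite -[k.+1 in leqLHS]card_ord -sum_nat_const; apply: leq_sum => d _.
by rewrite /c; case: arg_minnP => // i _; apply.
Qed.

(** The new vertex goes to the class that contains the fewest of its
    neighbours, hence at most the fraction 1 / (q + 1) of them. *)
Lemma extend_coloring (T : finType) (g : rel T) (q : nat) (f : T -> 'I_q.+1)
    (S : {set T}) (x : T) :
    symmetric g -> x \notin S ->
  exists f' : T -> 'I_q.+1,
    q.+1 * arcs (cut g f) S + 2 * q * degree_in g S x
      <= q.+1 * arcs (cut g f') (x |: S).
Proof.
move=> gs xS.
pose F c := \sum_(y in S) (g x y && (f y == c)).
have [c Fc] := exists_le_average F.
have sF : \sum_c F c = degree_in g S x.
  rewrite /F exchange_big; apply: eq_bigr => y yS.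
  rewrite (bigD1 (f y)) //= eqxx andbT big1 ?addn0 // => d.
  by rewrite eq_sym => /negbTE->; rewrite andbF.
pose f' y := if y == x then c else f y.
have f'S y : y \in S -> f' y = f y.
  by rewrite /f'; case: eqP => // -> ; rewrite (negbTE xS).
exists f'; rewrite arcsU1 //; [|exact: cut_sym|exact: cut_irr].
rewrite (eq_arcs (e' := cut g f)); last first.
  by move=> y z yS zS; rewrite /cut !f'S.
have dF : degree_in (cut g f') S x + F c = degree_in g S x.
  rewrite /degree_in /F -big_split; apply: eq_bigr => y yS /=.
  rewrite /cut (f'S y) // /f' eqxx eq_sym.
  by case: (g x y) => //=; case: eqP.
move: Fc; rewrite sF -dF; move: (F c) (degree_in _ _ _) (arcs _ _) => a b d h.
nia.
Qed.

Lemma finset_ind (T : finType) (P : {set T} -> Prop) :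
  P set0 -> (forall x (S : {set T}), x \notin S -> P S -> P (x |: S)) -> forall S, P S.
Proof.
move=> P0 PU S; move: {2}#|S| (erefl #|S|) => n; elim: n S => [|n IH] S.
  by move/cards0_eq->.
move=> Sn; have /card_gt0P[x xS] : 0 < #|S| by rewrite Sn.
rewrite -(setD1K xS); apply: PU; first by rewrite !inE eqxx.
by apply: IH; move: Sn; rewrite (cardsD1 x) xS => -[].
Qed.

Lemma greedy_cut (T : finType) (g : rel T) (q : nat) (S : {set T}) :
    symmetric g -> irreflexive g ->
  exists f : T -> 'I_q.+1, q * arcs g S <= q.+1 * arcs (cut g f) S.
Proof.
move=> gs gi; elim/finset_ind: S => [|x S xS [f hf]].
  by exists (fun=> ord0); rewrite /arcs big_set0 muln0.
have [f' hf'] := extend_coloring f gs xS; exists f'.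
apply: leq_trans hf'; rewrite arcsU1 // mulnDr leq_add //.
by rewrite mulnCA mulnA.
Qed.

Lemma square_sum_le (k : nat) (F : 'I_k -> nat) :
  (\sum_c F c) ^ 2 <= k * \sum_c F c ^ 2.
Proof.
have h : \sum_c \sum_d 2 * (F c * F d) <= \sum_c \sum_d (F c ^ 2 + F d ^ 2).
  by apply: leq_sum => c _; apply: leq_sum => d _; exact: nat_Cauchy.
rewrite -(leq_pmul2l (isT : 0 < 2)).
have -> : 2 * (\sum_c F c) ^ 2 = \sum_c \sum_d 2 * (F c * F d).
  rewrite -mulnn big_distrlr /= big_distrr /=; apply: eq_bigr => c _.
  by rewrite big_distrr.
apply: leq_trans h _.
rewrite (eq_bigr (fun c => k * F c ^ 2 + \sum_d F d ^ 2)) => [|c _].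
  by rewrite big_split /= -big_distrr /= sum_nat_const card_ord mul2n -addnn.
by rewrite big_split /= sum_nat_const card_ord.
Qed.

(** The arcs miss the pairs inside a class, whose number is the sum of the
    squares of the class sizes; Cauchy-Schwarz bounds it from below. *)
Lemma partite_arcs_le (T : finType) (e : rel T) (q : nat) (f : T -> 'I_q.+1)
    (S : {set T}) :
    {in S &, forall x y, e x y -> f x != f y} ->
  q.+1 * arcs e S <= q * #|S| ^ 2.
Proof.
move=> ef.
pose F c := \sum_(x in S) (f x == c).
have Fx x : \sum_c (f x == c) = 1.
  rewrite (bigD1 (f x)) //= eqxx big1 // => c.
  by rewrite eq_sym => /negbTE->.
have sF : \sum_c F c = #|S|.
  by rewrite /F exchange_big -sum1_card; apply: eq_bigr.
have sF2 : \sum_c F c ^ 2 = \sum_(x in S) \sum_(y in S) (f x == f y).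
  rewrite (eq_bigr (fun c => \sum_(x in S) \sum_(y in S) ((f x == c) * (f y == c)))).
    rewrite exchange_big; apply: eq_bigr => x xS; rewrite exchange_big.
    apply: eq_bigr => y yS; rewrite (bigD1 (f x)) //= eqxx mul1n big1 ?addn0.
      by rewrite eq_sym.
    by move=> c; rewrite eq_sym => /negbTE->.
  by move=> c _; rewrite -mulnn /F big_distrlr.
have h : arcs e S + \sum_c F c ^ 2 <= #|S| ^ 2.
  have -> : #|S| ^ 2 = \sum_(x in S) \sum_(y in S) 1.
    by rewrite !sum_nat_const muln1 mulnn.
  rewrite sF2 /arcs -big_split /=.
  apply: leq_sum => x xS; rewrite /degree_in -big_split; apply: leq_sum => y yS /=.
  by case exy: (e x y) => /=; [rewrite (negbTE (ef _ _ xS yS exy))|case: eqP].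
have := square_sum_le F; rewrite sF; move: h.
move: (arcs e S) (\sum_c _) (#|S| ^ 2) => a b c; nia.
Qed.

Lemma Andrasfai_Erdos_Sos_in (T : finType) (e : rel T) (q : nat) (S : {set T}) :
    symmetric e -> irreflexive e -> clique_free q.+2 e ->
    {in S, forall x, (3 * q + 2) * (#|S| - degree_in e S x) < 3 * #|S|} ->
  exists f : T -> 'I_q.+1, {in S &, forall x y, e x y -> f x != f y}.
Proof.
move=> es ei ef nd.
pose U : finType := {x : T | x \in S}.
pose e1 : rel U := fun x y => e (val x) (val y).
have cU : #|U| = #|S| by rewrite card_sig; apply: eq_card => x; rewrite inE.
have [] := @Andrasfai_Erdos_Sos U e1 q.
- by move=> x y; rewrite /e1 es.
- by move=> x; rewrite /e1 ei.
- move=> A /is_cliqueP Ac; rewrite -(card_imset (mem A) val_inj); apply: ef.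
  apply/is_cliqueP => _ _ /imsetP[x xA ->] /imsetP[y yA ->] xy.
  by apply: Ac => //; apply: contra xy => /eqP->.
- move=> x; rewrite cU; apply: leq_ltn_trans (nd _ (valP x)).
  rewrite leq_mul2l; apply/orP; right; rewrite leq_subRL; last first.
    rewrite -sum1_card; apply: leq_sum => y _; exact: leq_b1.
  rewrite /nonnbr -(card_imset _ val_inj).
  have -> : degree_in e S (val x) = #|[set y in S | e (val x) y]|.
    rewrite -sum1_card /degree_in [LHS]big_mkcond [RHS]big_mkcond /=.
    apply: eq_bigr => y _.
    by rewrite inE; case: (y \in S) => //=; case: (e _ _).
  rewrite -cardsUI [X in _ + X](_ : _ = 0) ?addn0.
    apply/subset_leq_card/subsetP => y; rewrite !inE.
    case/orP => [/andP[]//|/imsetP[z _ ->]]; exact: valP.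
  apply/eqP; rewrite cards_eq0 -subset0; apply/subsetP => y; rewrite !inE.
  by case/andP => /andP[_ xy] /imsetP[z]; rewrite inE /e1 => xz yz; rewrite -yz xy in xz.
move=> f hf; exists (fun x => if insub x is Some u then f u else ord0).
move=> x y xS yS xy; rewrite (insubT (fun x => x \in S) xS) (insubT (fun x => x \in S) yS).
exact: hf.
Qed.

(** Here m is the order of the dense part that survives the deletions, L is
    twice the number of edges of h in it and j is the number of deletions.
    With a = (3q-1)/(3q+2) the third clause says that
    arcs h S - L <= a (|S| (|S|+1) - m (m+1)), each deleted vertex having
    degree at most a times the order of the current set.  The fourth says that
    the cut recovers, for each vertex put back into a set of order i - 1, twice
    q / (q+1) times D - |T| + i, a lower bound for its degree in g towards that
    set.  Everything is multiplied out and arranged so that only natural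
    numbers occur. *)
Lemma peel_and_recolor (T : finType) (g h : rel T) (q D : nat) (S : {set T}) :
    symmetric g -> irreflexive g -> symmetric h -> irreflexive h ->
    subrel h g -> clique_free q.+2 h -> (forall x, D <= degree_in g setT x) ->
  exists f : T -> 'I_q.+1, exists m j L : nat,
  [/\ #|S| = m + j,
      q.+1 * L <= q * m ^ 2,
      (3 * q + 2) * arcs h S + 3 * q * (m * m.+1) + #|S| * #|S|.+1
        <= (3 * q + 2) * L + 3 * q * (#|S| * #|S|.+1) + m * m.+1
    & q.+1 * L + q * (2 * j * D + #|S| * #|S|.+1)
        <= q.+1 * arcs (cut g f) S + q * (2 * j * #|T| + m * m.+1)].
Proof.
move=> gs gi hs hi hg hf gD.
move: {2}#|S| (erefl #|S|) => n; elim: n S => [|n IH] S Sn.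
  exists (fun=> ord0), 0, 0, 0; move/cards0_eq: Sn => ->.
  by rewrite cards0 /arcs !big_set0 !muln0.
have [/forall_inP dense|] :=
    boolP [forall x in S, (3 * q + 2) * (#|S| - degree_in h S x) < 3 * #|S|].
  have [f hfc] := Andrasfai_Erdos_Sos_in hs hi hf dense.
  exists f, #|S|, 0, (arcs h S); split; rewrite ?addn0 //.
    exact: partite_arcs_le hfc.
  rewrite !muln0 !mul0n !add0n leq_add2r leq_mul2l; apply/orP; right.
  apply: sub_arcs => x y xS yS xy.
  by rewrite /cut (hg _ _ xy) (hfc x y xS yS xy).
rewrite negb_forall_in => /exists_inP[x xS]; rewrite -leqNgt => sparse.
pose S' := S :\ x.
have xS' : x \notin S' by rewrite !inE eqxx.
have ES : S = x |: S' by rewrite setD1K.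
have S'n : #|S'| = n by move: Sn; rewrite (cardsD1 x) xS => -[].
have [f [m [j [L [h1 h2 h3 h4]]]]] := IH _ S'n.
have [f' hf'] := extend_coloring f gs xS'.
have dS : degree_in h S x = degree_in h S' x.
  by rewrite ES /degree_in big_setU1 //= hi.
have dT : D + n.+1 <= degree_in g S' x + #|T|.
  have -> : #|T| = n.+1 + \sum_(y in ~: S) 1.
    by rewrite sum1_card -Sn cardsC.
  rewrite addnCA addnC leq_add2l; apply: leq_trans (gD x) _.
  rewrite /degree_in (bigID (mem S')) /=; apply: leq_add.
    by rewrite (eq_bigl (mem S')) // => y; rewrite !inE.
  rewrite [leqRHS]big_mkcond [leqLHS]big_mkcond; apply: leq_sum => y _.
  rewrite !inE; case: (y == x) / eqP => [->|_] /=; first by rewrite xS gi.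
  by case: (y \in S); rewrite //= leq_b1.
exists f', m, j.+1, L; split=> //.
- by rewrite addnS -h1 S'n.
- rewrite ES arcsU1 // -ES Sn.
  have h5 : (3 * q + 2) * degree_in h S' x + n.+1 <= 3 * q * n.+1.
    have le : degree_in h S' x <= n.+1.
      rewrite -dS -Sn -sum1_card; apply: leq_sum => y _; exact: leq_b1.
    by move: sparse; rewrite dS Sn; move: le; clear; move: (degree_in _ _ _) => d; nia.
  move: h3 h5; rewrite S'n; clear; move: (degree_in _ _ _) (arcs _ _) => d a; nia.
- move: hf' h4; rewrite -ES S'n Sn.
  have {}dT : q * (D + n.+1) <= q * (degree_in g S' x + #|T|) by rewrite leq_mul2l dT orbT.
  move: dT; clear; move: (arcs _ _) (arcs _ _) (degree_in _ _ _) #|T| => a b d t; nia.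
Qed.

(** The condition on D is 4 (b D - a n) >= (b - a) n + o(n), with b = q / (q+1),
    a = (3q-1)/(3q+2) and n = |T|, multiplied by (q+1)(3q+2). *)
Lemma coloring_beats_clique_free (T : finType) (g h : rel T) (q D : nat) :
    0 < q ->
    symmetric g -> irreflexive g -> symmetric h -> irreflexive h ->
    subrel h g -> clique_free q.+2 h -> (forall x, D <= degree_in g setT x) ->
    q * arcs g setT <= q.+1 * arcs h setT ->
    (12 * q * q.+1 + 1) * #|T| + 12 * q * q.+1
      <= 4 * (3 * q + 2) * q * D + 4 * q.+1 * #|T| ->
  exists f : T -> 'I_q.+1, arcs h setT <= arcs (cut g f) setT.
Proof.
move=> q0 gs gi hs hi hg hf gD hmax hD.
have [f [m [j [L [h1 h2 h3 h4]]]]] := peel_and_recolor setT gs gi hs hi hg hf gD.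
exists f.
have {}hmax : q * (#|T| * D) <= q.+1 * arcs h setT.
  apply: leq_trans hmax; rewrite leq_mul2l; apply/orP; right.
  by rewrite -cardsT -sum_nat_const; apply: leq_sum => x _.
move: h1 h2 h3 h4 hmax hD q0; rewrite cardsT; clear.
move: (arcs h setT) (arcs (cut g f) setT) #|T| => a b n -> {n} h1 h2 h3 hmax hD q0.
set n := m + j in h2 h3 hmax hD *.
(* At least half of the vertices survive: the edges of h are too many for
   them to come from a smaller dense part and vertices of small degree. *)
have jm : j <= m.
  rewrite leqNgt; apply/negP => mj.
  have k1 : (3 * q + 2) * (q * (n * D)) <= (3 * q + 2) * (q.+1 * a).
    by rewrite leq_mul2l hmax orbT.
  have k2 : (3 * q + 2) * (q.+1 * L) <= (3 * q + 2) * (q * m ^ 2).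
    by rewrite leq_mul2l h1 orbT.
  have k3 := leq_mul (leqnn q.+1) h2.
  have k4 := leq_mul (leqnn n) hD.
  have k0 : 2 * m < n by rewrite /n mul2n -addnn ltn_add2l.
  have k5 : 2 * m * (2 * m) < n * n by rewrite ltn_mul.
  move: k1 k2 k3 k4 k5 => {h1 h2 h3 hmax hD}.
  have : m <= n by rewrite /n leq_addr.
  clear; clearbody n => mn k1 k2 k3 k4 k5.
  have k6 : q * q * m <= q * q * n by rewrite leq_mul2l mn orbT.
  have k7 : q * m <= q * n by rewrite leq_mul2l mn orbT.
  lia.
have k1 := leq_mul (leqnn q.+1) h2.
have k2 := leq_mul (leqnn (3 * q + 2)) h3.
have k3 := leq_mul (leqnn j) hD.
have k4 : j * (2 * j) <= j * n by rewrite leq_mul2l /n; apply/orP; right; lia.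
have k5 : 0 < (3 * q + 2) * q.+1 by rewrite muln_gt0 addn2.
rewrite -(leq_pmul2l k5).
move: k1 k2 k3 k4; rewrite /n; clear => *; nia.
Qed.

(** * Weighted graphs and joins *)

Definition warcs (V : finType) (w : V -> nat) (e : rel V) : nat :=
  \sum_u w u * \sum_(v | e u v) w v.

(** A vertex v of weight w v stands for an independent set of w v vertices.
    The bound on the weighted degrees is what allows joining a vertex of weight
    s. *)
Record separating (k s N : nat) (V : finType) (w : V -> nat) (g h : rel V) :
    Prop := Separating {
  sep_sym : symmetric g;
  sep_irr : irreflexive g;
  sep_hsym : symmetric h;
  sep_sub : subrel h g;
  sep_free : clique_free k.+1 h;
  sep_gap : forall f : V -> 'I_k, warcs w (cut g f) < warcs w h;
  sep_nonnbr : forall u, \sum_(v | ~~ g u v) w v <= s;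
  sep_deg : forall u, \sum_(v | g u v) w v <= k * s;
  sep_total : \sum_v w v = N }.

Definition joined (V : finType) (e : rel V) : rel (option V) := fun x y =>
  match x, y with
  | Some u, Some v => e u v
  | None, None => false
  | _, _ => true
  end.

Definition jweight (V : finType) (w : V -> nat) (s : nat) (x : option V) : nat :=
  if x is Some v then w v else s.

Lemma big_option (V : finType) (P : pred (option V)) (F : option V -> nat) :
  \sum_(x | P x) F x
    = (if P None then F None else 0) + \sum_(v | P (Some v)) F (Some v).
Proof.
rewrite big_mkcond (bigD1 None) //=; congr (_ + _).
rewrite (reindex_omap Some id) /= => [|[v|]] //.
rewrite [RHS]big_mkcond /=; apply: eq_big => v; first by rewrite eqxx.
by [].
Qed.

Lemma warcs_joined (V : finType) (w : V -> nat) (s : nat) (e : rel V) :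
  warcs (jweight w s) (joined e) = warcs w e + 2 * (s * \sum_v w v).
Proof.
have E u : jweight w s (Some u) * \sum_(y | joined e (Some u) y) jweight w s y
    = w u * s + w u * \sum_(v | e u v) w v by rewrite big_option mulnDr.
rewrite {1}/warcs big_option (eq_bigr _ (fun u _ => E u)) /= big_option /= add0n.
rewrite big_split /= -big_distrl /= -/(warcs w e).
by move: (warcs _ _) (\sum_v w v); clear; lia.
Qed.

Lemma joined_clique_free (V : finType) (e : rel V) (k : nat) :
  clique_free k e -> clique_free k.+1 (joined e).
Proof.
move=> ef A /is_cliqueP Ac.
have : #|Some @^-1: A| < k.
  apply: ef; apply/is_cliqueP => u v; rewrite !inE => uA vA uv.
  exact: Ac uA vA uv.
suff h : #|A| <= #|Some @^-1: A|.+1 by move=> h'; exact: leq_ltn_trans h _.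
rewrite -(card_imset (Some @^-1: A) (@Some_inj _)).
apply: leq_trans (_ : #|None |: [set Some x | x in Some @^-1: A]| <= _).
  apply/subset_leq_card/subsetP => -[v|] vA; rewrite !inE //=.
  by apply/imsetP; exists v; rewrite ?inE.
by rewrite cardsU1; case: (_ \notin _).
Qed.

Lemma warcs_move (V : finType) (w : V -> nat) (e : rel V) (v : V) :
  symmetric e -> irreflexive e ->
  warcs w e = warcs w (fun x y => [&& e x y, x != v & y != v])
              + 2 * (w v * \sum_(u | e v u) w u).
Proof.
move=> es ei; set e' := fun x y => _.
have E u : u != v -> w u * \sum_(y | e u y) w y
    = w u * (\sum_(y | e' u y) w y) + w v * (if e v u then w u else 0).
  move=> uv; rewrite (bigID (fun y => y != v)) /= mulnDr; congr (_ * _ + _).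
    by apply: eq_bigl => y; rewrite /e' uv.
  case: (boolP (e v u)) => evu.
    rewrite (big_pred1 v) 1?mulnC // => y /=; rewrite negbK.
    by case: eqP => [->|]; rewrite ?andbF // es evu.
  rewrite big_pred0 ?muln0 // => y /=; rewrite negbK.
  by case: eqP => [->|]; rewrite ?andbF // es (negbTE evu).
have E'v : \sum_(y | e' v y) w y = 0.
  by rewrite big_pred0 // => y; rewrite /e' eqxx andbF.
have Ev : \sum_(u | u != v) (if e v u then w u else 0) = \sum_(u | e v u) w u.
  rewrite -big_mkcondr; apply: eq_bigl => u /=.
  by case: eqP => [->|]; rewrite ?ei.
rewrite /warcs (bigD1 v) //= (eq_bigr _ E) big_split -big_distrr Ev /=.
rewrite [in RHS](bigD1 v) //= E'v muln0 add0n.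
by rewrite addnCA mul2n -addnn.
Qed.

Lemma eq_warcs (V : finType) (w : V -> nat) (e e' : rel V) :
  e =2 e' -> warcs w e = warcs w e'.
Proof.
move=> ee; apply: eq_bigr => u _; congr (_ * _); apply: eq_bigl => v; exact: ee.
Qed.

(** Class i can be emptied by moving its vertices one by one to the class where
    they have the least weight of neighbours.  That weight is at most s by the
    bound on degrees, so that moving v costs at most s * w v edges. *)
Lemma empty_class (V : finType) (w : V -> nat) (g : rel V) (k s : nat)
    (i : 'I_k.+2) (f : V -> 'I_k.+2) :
    symmetric g -> irreflexive g ->
    (forall u, \sum_(v | g u v) w v <= k.+1 * s) ->
  exists2 f' : V -> 'I_k.+2, forall v, f' v != i
    & warcs w (cut g f) <= warcs w (cut g f') + 2 * (s * \sum_(v | f v == i) w v).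
Proof.
move=> gs gi gd.
move: {2}#|_| (erefl #|[pred v | f v == i]|) => n.
elim: n f => [|n IH] f fn.
  exists f; last exact: leq_addr.
  by move=> v; apply/negP => fv; move: (card0_eq fn v); rewrite inE fv.
have /card_gt0P[v] : 0 < #|[pred v | f v == i]| by rewrite fn.
rewrite inE => fv.
pose F c := \sum_(u | g v u && (f u == lift i c)) w u.
have [c Fc] := exists_le_average F.
have {Fc} Fc : F c <= s.
  rewrite -(leq_pmul2l (ltn0Sn k)); apply: leq_trans Fc _; apply: leq_trans (gd v).
  rewrite /F (exchange_big_dep (g v)) /=; last by move=> ? u _ /andP[].
  apply: leq_sum => u gvu; rewrite gvu /=.
  case: (unliftP i (f u)) => [d ->|->]; last first.
    by rewrite big1 // => d; rewrite (negbTE (neq_lift _ _)).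
  by rewrite (big_pred1 d) // => d'; rewrite (inj_eq lift_inj) eq_sym.
pose f1 u := if u == v then lift i c else f u.
have f1v : f1 v = lift i c by rewrite /f1 eqxx.
have f1u u : u != v -> f1 u = f u by rewrite /f1 => /negbTE->.
have cls u : (f1 u == i) = (u != v) && (f u == i).
  have [->|uv] := eqVneq u v; last by rewrite f1u.
  by rewrite f1v eq_sym (negbTE (neq_lift _ _)).
have [f' f'i f'f1] : exists2 f' : V -> 'I_k.+2, forall v, f' v != i
    & warcs w (cut g f1) <= warcs w (cut g f') + 2 * (s * \sum_(v | f1 v == i) w v).
  apply: IH; move: fn; rewrite (cardD1 v) inE fv add1n => -[<-].
  by apply: eq_card => u; rewrite !inE cls.
exists f' => //.
have -> : \sum_(u | f u == i) w u = w v + \sum_(u | f1 u == i) w u.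
  rewrite (bigD1 v) //=; congr (_ + _); apply: eq_bigl => u.
  by rewrite cls andbC.
suff : warcs w (cut g f) <= warcs w (cut g f1) + 2 * (s * w v).
  by move: f'f1; clear; lia.
rewrite (warcs_move w v (cut_sym f gs) (cut_irr g f)).
rewrite (warcs_move w v (cut_sym f1 gs) (cut_irr g f1)).
rewrite (eq_warcs w (e' := fun x y => [&& cut g f1 x y, x != v & y != v])); last first.
  move=> x y; rewrite /cut; case xv: (x == v); first by rewrite !andbF.
  by case yv: (y == v); rewrite ?andbF // !f1u ?xv ?yv.
rewrite -addnA leq_add2l -mulnDr leq_pmul2l // [s * _]mulnC -mulnDr.
rewrite leq_mul2l; apply/orP; right.
apply: leq_trans (_ : \sum_(u | g v u) w u <= _).
  rewrite [leqRHS]big_mkcond [leqLHS]big_mkcond /=; apply: leq_sum => u _.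
  by rewrite /cut; case: (g v u) => //=; case: (_ != _).
rewrite (bigID (fun u => f u != lift i c)) /=; apply: leq_add.
  rewrite [leqRHS]big_mkcond [leqLHS]big_mkcond /=; apply: leq_sum => u _.
  rewrite /cut f1v; have [->|uv] := eqVneq u v; first by rewrite gi.
  by rewrite f1u // eq_sym.
by apply: leq_trans Fc; rewrite /F (eq_bigl (fun u => g v u && (f u == lift i c)))
  // => u; rewrite negbK.
Qed.

(** In a partition of the join, the vertices that share the class of the new
    vertex lose s times their weight; by [empty_class] they do at least as well
    in the other classes, so the new vertex may be assumed to be alone. *)
Lemma separating_join (k s N : nat) (V : finType) (w : V -> nat) (g h : rel V) :
    0 < k -> N <= k.+1 * s -> separating k s N w g h ->
  separating k.+1 s (N + s) (jweight w s) (joined g) (joined h).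
Proof.
case: k => // k _ Nk [gs gi hs hg hf gap nn dg tot]; split.
- by case=> [u|] [v|] //=; exact: gs.
- by case=> [u|] //=; exact: gi.
- by case=> [u|] [v|] //=; exact: hs.
- by case=> [u|] [v|] //=; exact: hg.
- exact: joined_clique_free.
- move=> f; rewrite warcs_joined.
  have [f' f'i hf'] := empty_class (f None) (fun v => f (Some v)) gs gi dg.
  have {f'i} [f0 f0f'] : exists f0 : V -> 'I_k.+1, forall v, f' v = lift (f None) (f0 v).
    exists (fun v => odflt ord0 (unlift (f None) (f' v))) => v.
    by case: unliftP (f'i v) => [j ->|->] //=; rewrite eqxx.
  have := gap f0; rewrite (eq_warcs w (e' := cut g f')); last first.
    by move=> u v; rewrite /cut !f0f' (inj_eq lift_inj).
  have -> : warcs (jweight w s) (cut (joined g) f) =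
      warcs w (cut g (fun v => f (Some v))) + 2 * (s * \sum_(v | f (Some v) != f None) w v).
    have E u : jweight w s (Some u) * \sum_(y | cut (joined g) f (Some u) y) jweight w s y
        = (if f (Some u) != f None then w u else 0) * s
          + w u * \sum_(v | cut g (fun v => f (Some v)) u v) w v.
      by rewrite big_option /= mulnDr; congr (_ + _); rewrite /cut /=; case: (_ != _); rewrite ?muln0.
    rewrite {1}/warcs big_option (eq_bigr _ (fun u _ => E u)) /= big_option /= add0n.
    rewrite big_split /= -big_distrl /= -big_mkcond -/(warcs _ _).
    rewrite (eq_bigl (fun v => f (Some v) != f None)) /=; last first.
      by move=> v; rewrite /cut /= eq_sym.
    by clear; lia.
  rewrite [\sum_v w v](bigID (fun v => f (Some v) == f None)) /=.
  by move: hf'; clear; lia.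
- case=> [u|]; rewrite big_option /= ?add0n //.
  by rewrite big_pred0 ?addn0.
- case=> [u|]; rewrite big_option /=; first by rewrite mulSn leq_add2l.
  by rewrite add0n (eq_bigl xpredT) // tot.
- by rewrite big_option /= tot addnC.
Qed.

(** * The weighted graph on nine vertices *)

(** The vertices 0, ..., 8 are A1, B1, A2, B2, A3, B3, A4, B4 and u.  The free
    graph consists of u joined to A1 and B1 and of all pairs between the sides
    A = {A1, A2, A3, A4} and B = {B1, B2, B3, B4} except A1 B1 and A4 B4; it is
    triangle-free because A1 and B1 are not adjacent.  The other edges of the
    base graph lie inside A, inside B or between u and A2, B2.

    Cutting along A, B loses the edges inside the sides, as does the free
    graph, and in addition the smaller half of the edges at u, of weight
    16 + 15 = 31, whereas the free graph loses at u only those to A2 and B2, of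
    weight 15 + 15 = 30.  Without A4 and B4, moving A1 or B1 to the other side
    would be free, after which u loses only 15; the edges A1 B4 and B1 A4 make
    such moves costly. *)
Definition base_weight : seq nat := [:: 16; 16; 15; 15; 17; 17; 1; 1; 1].

Definition base_free_edges : seq (nat * nat) :=
  [:: (0, 3); (0, 5); (0, 7); (2, 1); (2, 3); (2, 5); (2, 7); (4, 1); (4, 3);
      (4, 5); (4, 7); (6, 1); (6, 3); (6, 5); (8, 0); (8, 1)].

Definition base_side_edges : seq (nat * nat) :=
  [:: (0, 2); (0, 4); (1, 3); (1, 5); (2, 6); (3, 7); (8, 2); (8, 3)].

Definition rel_of_edges (l : seq (nat * nat)) (i j : nat) : bool :=
  ((i, j) \in l) || ((j, i) \in l).

Definition base_free : rel 'I_9 := fun i j => rel_of_edges base_free_edges i j.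

Definition base_graph : rel 'I_9 :=
  fun i j => rel_of_edges (base_free_edges ++ base_side_edges) i j.

Definition base_w (i : 'I_9) : nat := nth 0 base_weight i.

Lemma sum_ord_seq (n : nat) (P : pred nat) (F : nat -> nat) :
  \sum_(i < n | P i) F i = sumn [seq (if P i then F i else 0) | i <- iota 0 n].
Proof.
by rewrite sumnE big_map -(big_mkord P) /index_iota subn0 big_mkcond.
Qed.

Fixpoint all_bitseqs (n : nat) (P : pred (seq bool)) : bool :=
  if n is n'.+1 then
    all_bitseqs n' (fun s => P (true :: s)) && all_bitseqs n' (fun s => P (false :: s))
  else P [::].

Lemma all_bitseqsP (n : nat) (P : pred (seq bool)) (s : seq bool) :
  all_bitseqs n P -> size s = n -> P s.
Proof.
elim: n P s => [|n IH] P [|b s] //= /andP[h1 h2] [sn].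
by case: b; [apply: (IH (fun s => P (true :: s)))|apply: (IH (fun s => P (false :: s)))].
Qed.

Definition seq_warcs (P : nat -> nat -> bool) : nat :=
  sumn [seq nth 0 base_weight i *
    sumn [seq (if P i j then nth 0 base_weight j else 0) | j <- iota 0 9]
  | i <- iota 0 9].

Lemma warcs_baseE (P : nat -> nat -> bool) :
  warcs base_w (fun i j => P i j) = seq_warcs P.
Proof.
rewrite /warcs (eq_bigr (fun i : 'I_9 => nth 0 base_weight i *
    sumn [seq (if P i j then nth 0 base_weight j else 0) | j <- iota 0 9])).
  by rewrite (sum_ord_seq 9 xpredT (fun i => nth 0 base_weight i *
    sumn [seq (if P i j then nth 0 base_weight j else 0) | j <- iota 0 9])).
by move=> i _; congr (_ * _); rewrite -(sum_ord_seq 9 (P i)).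
Qed.

Lemma all_ord9 (P : pred nat) : all P (iota 0 9) -> forall i : 'I_9, P i.
Proof. by move=> /allP h i; apply: h; rewrite mem_iota ltn_ord. Qed.

(** A cut is encoded by the bit sequence of its colours, so that the 2^9 cuts
    can be checked by evaluation. *)
Lemma base_separating : separating 2 37 99 base_w base_graph base_free.
Proof.
split.
- by move=> i j; rewrite /base_graph /rel_of_edges orbC.
- move=> i; apply/negbTE; move: i.
  by apply: (@all_ord9 (fun i => ~~ rel_of_edges (base_free_edges ++ base_side_edges) i i)).
- by move=> i j; rewrite /base_free /rel_of_edges orbC.
- move=> i j; rewrite /base_graph /base_free /rel_of_edges !mem_cat.
  by case/orP => ->; rewrite ?orbT.
- move=> A /is_cliqueP Ac; rewrite ltnNge; apply/negP => /card_gt2P.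
  move=> [x [y [z [[xA yA zA] [xy yz zx]]]]].
  have := Ac _ _ xA yA xy; have := Ac _ _ yA zA yz; have := Ac _ _ zA xA zx.
  have : all (fun i => all (fun j => all (fun l =>
      rel_of_edges base_free_edges l i ==> rel_of_edges base_free_edges j l ==>
      ~~ rel_of_edges base_free_edges i j) (iota 0 9)) (iota 0 9)) (iota 0 9).
    by vm_compute.
  move/all_ord9/(_ x)/all_ord9/(_ y)/all_ord9/(_ z).
  by rewrite /base_free => /implyP h /h /implyP h' /h' /negbTE->.
- move=> f.
  pose c := [seq f (inord i) == ord0 | i <- iota 0 9].
  have fc (i j : 'I_9) : (f i != f j) = (nth true c i != nth true c j).
    have cE (l : 'I_9) : nth true c l = (f l == ord0).
      by rewrite (nth_map 0) ?size_iota // nth_iota // add0n inord_val.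
    rewrite !cE; have twoP (a : 'I_2) : a = ord0 \/ a = ord_max.
      by case: a => -[|[|//]] la; [left|right]; exact: val_inj.
    by case: (twoP (f i)) => ->; case: (twoP (f j)) => ->.
  rewrite (eq_warcs _ (e' := fun i j : 'I_9 => rel_of_edges (base_free_edges ++ base_side_edges) i j
    && (nth true c i != nth true c j))); last by move=> i j; rewrite /cut fc.
  rewrite (warcs_baseE (fun i j => rel_of_edges _ i j && (nth true c i != nth true c j))).
  rewrite (warcs_baseE (rel_of_edges base_free_edges)).
  have cuts : all_bitseqs 9 (fun c => seq_warcs (fun i j =>
      rel_of_edges (base_free_edges ++ base_side_edges) i j
        && (nth true c i != nth true c j))
      < seq_warcs (rel_of_edges base_free_edges)) by vm_compute.
  by apply: (all_bitseqsP cuts); rewrite size_map size_iota.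
- move=> i; rewrite /base_graph /base_w.
  rewrite (sum_ord_seq 9 (fun j => ~~ rel_of_edges _ i j) (nth 0 base_weight)).
  have sums : all (fun i => sumn [seq (if ~~ rel_of_edges
      (base_free_edges ++ base_side_edges) i j then nth 0 base_weight j else 0)
      | j <- iota 0 9] <= 37) (iota 0 9) by vm_compute.
  exact: (all_ord9 sums).
- move=> i; rewrite /base_graph /base_w.
  rewrite (sum_ord_seq 9 (fun j => rel_of_edges _ i j) (nth 0 base_weight)).
  have sums : all (fun i => sumn [seq (if rel_of_edges
      (base_free_edges ++ base_side_edges) i j then nth 0 base_weight j else 0)
      | j <- iota 0 9] <= 2 * 37) (iota 0 9) by vm_compute.
  exact: (all_ord9 sums).
- by rewrite /base_w (sum_ord_seq 9 xpredT (nth 0 base_weight)).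
Qed.

Lemma exists_separating (k : nat) :
  exists (V : finType) (w : V -> nat) (g h : rel V),
    separating k.+2 37 (99 + k * 37) w g h.
Proof.
elim: k => [|k [V [w [g [h sep]]]]].
  by exists 'I_9, base_w, base_graph, base_free; exact: base_separating.
exists (option V), (jweight w 37), (joined g), (joined h).
rewrite mulSn addnCA addnC; apply: separating_join => //; lia.
Qed.

(** * Blow-ups *)

Lemma arcs_relpre (T V : finType) (p : T -> V) (e : rel V) :
  arcs (relpre p e) setT = warcs (fun v => #|[set x | p x == v]|) e.
Proof.
have sumF (F : V -> nat) : \sum_(x : T) F (p x) = \sum_v #|[set x | p x == v]| * F v.
  rewrite (partition_big p xpredT) //=; apply: eq_bigr => v _.
  rewrite (eq_bigr (fun=> F v)) => [|x /eqP->] //.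
  by rewrite sum_nat_const cardsE.
rewrite /arcs /warcs big_mkcond /=.
rewrite (eq_bigr (fun x => \sum_(v | e (p x) v) #|[set y | p y == v]|)) => [|x _].
  by rewrite (sumF (fun u => \sum_(v | e u v) #|[set y | p y == v]|)).
rewrite inE /degree_in big_mkcond /= (eq_bigr (fun y => e (p x) (p y) : nat)) => [|y _].
  rewrite (sumF (fun v => e (p x) v : nat)) [RHS]big_mkcond; apply: eq_bigr => v _.
  by case: (e _ _); rewrite ?muln1 ?muln0.
by rewrite inE.
Qed.

Lemma relpre_clique_free (T V : finType) (p : T -> V) (e : rel V) (r : nat) :
  irreflexive e -> clique_free r e -> clique_free r (relpre p e).
Proof.
move=> ei ef A /is_cliqueP Ac; rewrite -(@card_in_imset _ _ p).
  apply: ef; apply/is_cliqueP => _ _ /imsetP[x xA ->] /imsetP[y yA ->] pxy.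
  by apply: Ac => //; apply: contraNneq pxy => ->.
move=> x y xA yA pxy; apply/eqP/negPn/negP => xy.
by have := Ac x y xA yA xy; rewrite /= pxy ei.
Qed.

Lemma arcs_split (T : finType) (e : rel T) (A : {set T}) :
  symmetric e -> {in A &, forall x y, ~~ e x y} ->
  arcs e setT = arcs e (~: A) + 2 * \sum_(x in A) degree_in e (~: A) x.
Proof.
move=> es eA.
have sp (F : T -> nat) : \sum_(x in setT) F x = \sum_(x in A) F x + \sum_(x in ~: A) F x.
  rewrite (bigID (mem A)) /=; congr (_ + _); apply: eq_bigl => x; by rewrite !inE.
rewrite /arcs sp.
have EA x : x \in A -> degree_in e setT x = degree_in e (~: A) x.
  move=> xA; rewrite /degree_in sp big1 ?add0n // => y yA.
  by rewrite (negbTE (eA _ _ xA yA)).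
have EC x : x \in ~: A -> degree_in e setT x = degree_in e A x + degree_in e (~: A) x.
  by move=> _; rewrite /degree_in sp.
rewrite (eq_bigr _ EA) (eq_bigr _ EC) big_split /=.
have -> : \sum_(x in ~: A) degree_in e A x = \sum_(x in A) degree_in e (~: A) x.
  rewrite /degree_in exchange_big; apply: eq_bigr => x _; apply: eq_bigr => y _.
  by rewrite es.
by rewrite mul2n -addnn addnA addnC.
Qed.

(** Zykov symmetrization: giving all vertices of a class of twins the colour of
    the one that is best cut from the rest cannot decrease the cut, since twins
    are pairwise non-adjacent. *)
Lemma symmetrize (T : finType) (e : rel T) (k : nat) (f : T -> 'I_k) (A : {set T}) :
    symmetric e -> {in A &, forall x y, ~~ e x y} ->
    {in A &, forall x y, e x =1 e y} ->
  exists f' : T -> 'I_k,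
    [/\ {in A &, forall x y, f' x = f' y}, {in ~: A, f' =1 f}
      & arcs (cut e f) setT <= arcs (cut e f') setT].
Proof.
move=> es eA twin.
have [->|[a0 a0A]] := set_0Vmem A.
  by exists f; split=> // x y; rewrite inE.
pose d := degree_in (cut e f) (~: A).
pose a := [arg max_(x > a0 in A) d x].
have [aA amax] : a \in A /\ forall x, x \in A -> d x <= d a.
  by rewrite /a; case: arg_maxnP.
pose f' x := if x \in A then f a else f x.
have f'A x : x \in A -> f' x = f a by rewrite /f' => ->.
have f'C x : x \in ~: A -> f' x = f x by rewrite inE /f' => /negbTE->.
have cutA f1 : {in A &, forall x y, ~~ cut e f1 x y}.
  by move=> x y xA yA; rewrite /cut (negbTE (eA _ _ xA yA)).
exists f'; split=> //; first by move=> x y xA yA; rewrite !f'A.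
rewrite (arcs_split (cut_sym f es) (cutA _ f)) (arcs_split (cut_sym f' es) (cutA _ f')).
rewrite (eq_arcs (e' := cut e f')); last first.
  by move=> x y xA yA; rewrite /cut !f'C.
rewrite leq_add2l leq_mul2l /=; apply: leq_sum => x xA.
apply: leq_trans (amax x xA) _; rewrite /d; apply: leq_sum => y yC.
by rewrite /cut f'A // f'C // (twin x a xA aA).
Qed.

(** After symmetrizing all fibres the cut is constant on them, hence comes from
    a cut of the base. *)
Lemma cut_relpre_le (T V : finType) (p : T -> V) (e : rel V) (q : nat)
    (f : T -> 'I_q.+1) :
    symmetric e -> irreflexive e ->
  exists f0 : V -> 'I_q.+1,
    arcs (cut (relpre p e) f) setT <= arcs (relpre p (cut e f0)) setT.
Proof.
move=> es ei.
have [f' f'p ff'] : exists2 f' : T -> 'I_q.+1,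
    forall x y, p x \in [set: V] -> p x = p y -> f' x = f' y
  & arcs (cut (relpre p e) f) setT <= arcs (cut (relpre p e) f') setT.
  elim/finset_ind: [set: V] => [|v S vS [f1 f1S ff1]].
    by exists f => // x y; rewrite inE.
  have [f2 [f2A f2C f12]] : exists f2 : T -> 'I_q.+1,
      [/\ {in [set x | p x == v] &, forall x y, f2 x = f2 y},
          {in ~: [set x | p x == v], f2 =1 f1}
        & arcs (cut (relpre p e) f1) setT <= arcs (cut (relpre p e) f2) setT].
    apply: symmetrize.
    - by move=> x y; rewrite /= es.
    - by move=> x y; rewrite !inE /= => /eqP-> /eqP->; rewrite ei.
    - by move=> x y; rewrite !inE => /eqP px /eqP py z; rewrite /= px py.
  exists f2; last exact: leq_trans ff1 f12.
  move=> x y; rewrite !inE => pxS pxy; have [pxv|pxv] := eqVneq (p x) v.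
    by apply: f2A; rewrite inE -?pxy pxv.
  rewrite !f2C ?inE -?pxy // ; apply: f1S pxy.
  by move: pxS; rewrite (negbTE pxv).
exists (fun v => odflt ord0 (omap f' [pick x | p x == v])).
apply: leq_trans ff' _; apply: sub_arcs => x y _ _ /=; rewrite /cut /=.
have fE z : odflt ord0 (omap f' [pick x | p x == p z]) = f' z.
  by case: pickP => [u /eqP uz|/(_ z)]; [apply: f'p; rewrite ?inE|rewrite eqxx].
by rewrite !fE.
Qed.

Lemma warcs_scale (V : finType) (w w' : V -> nat) (t : nat) (e : rel V) :
  (forall v, w' v = t * w v) -> warcs w' e = t ^ 2 * warcs w e.
Proof.
move=> w'E; rewrite /warcs big_distrr; apply: eq_bigr => u _ /=.
rewrite w'E (eq_bigr _ (fun v _ => w'E v)) -big_distrr /=.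
by rewrite -mulnn mulnACA mulnA.
Qed.

(** * Edge sets and relations *)

Lemma adjacent_sym (T : finType) (E : {set {set T}}) : symmetric (adjacent E).
Proof. by move=> x y; rewrite /adjacent setUC. Qed.

Lemma adjacent_irr (T : finType) (E : {set {set T}}) :
  simple_graph E -> irreflexive (adjacent E).
Proof.
move=> /forall_inP sE x; apply/negP => /sE.
by rewrite setUid cards1.
Qed.

Lemma sub_simple (T : finType) (E H : {set {set T}}) :
  H \subset E -> simple_graph E -> simple_graph H.
Proof.
by move=> /subsetP HE /forall_inP sE; apply/forall_inP => e /HE; exact: sE.
Qed.

(** Each edge has two orientations. *)
Lemma arcs_adjacent (T : finType) (E : {set {set T}}) :
  simple_graph E -> arcs (adjacent E) [set: T] = 2 * #|E|.
Proof.
move=> /forall_inP sE.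
have -> : arcs (adjacent E) setT = \sum_(p : T * T | [set p.1; p.2] \in E) 1.
  rewrite /arcs /degree_in big_mkcond /=.
  rewrite [RHS]big_mkcond -(pair_bigA _ (fun x y => if [set x; y] \in E then 1 else 0)) /=.
  apply: eq_bigr => x _; rewrite inE big_mkcond; apply: eq_bigr => y _.
  by rewrite inE /adjacent; case: (_ \in E).
rewrite (partition_big (fun p : T * T => [set p.1; p.2]) (mem E)) //=.
rewrite mulnC -sum_nat_const; apply: eq_bigr => e eE.
have /cards2P[a [b [ab eab]]] := sE e eE.
rewrite (eq_bigl (mem [set (a, b); (b, a)])); last first.
  move=> [x y]; rewrite !inE !xpair_eqE /=.
  apply/andP/orP => [[_ /eqP xye]|].
    have xe : x \in e by rewrite -xye !inE eqxx.
    have ye : y \in e by rewrite -xye !inE eqxx orbT.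
    have xy : x != y.
      by apply/eqP => xy; move: (sE e eE); rewrite -xye xy setUid cards1.
    move: xe ye xy; rewrite eab !inE => /orP[]/eqP-> /orP[]/eqP->;
      by rewrite ?eqxx; auto.
  by case=> /andP[/eqP-> /eqP->]; rewrite 1?[[set b; a]]setUC -eab eE eqxx.
by rewrite sum1_card cards2 xpair_eqE (negbTE ab).
Qed.

Definition graph_of (T : finType) (e : rel T) : {set {set T}} :=
  [set [set p.1; p.2] | p in [set p : T * T | e p.1 p.2]].

Lemma adjacent_graph_of (T : finType) (e : rel T) :
  symmetric e -> adjacent (graph_of e) =2 e.
Proof.
move=> es x y; apply/imsetP/idP => [[[a b]]|exy]; last by exists (x, y); rewrite ?inE.
rewrite inE /= => eab xyab.
have ha : a \in [set x; y] by rewrite xyab !inE eqxx.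
have hb : b \in [set x; y] by rewrite xyab !inE eqxx orbT.
have hx : x \in [set a; b] by rewrite -xyab !inE eqxx.
have hy : y \in [set a; b] by rewrite -xyab !inE eqxx orbT.
move: ha hb hx hy eab; rewrite !inE => /orP[]/eqP-> /orP[]/eqP-> //.
- by rewrite orbb => _ /orP[]/eqP->.
- by rewrite es.
- by rewrite orbb => /eqP->.
Qed.

Lemma graph_of_simple (T : finType) (e : rel T) :
  irreflexive e -> simple_graph (graph_of e).
Proof.
move=> ei; apply/forall_inP => e0 /imsetP[[x y]]; rewrite inE /= => exy ->.
by rewrite cards2 (_ : x != y) //; apply: contraTneq exy => ->; rewrite ei.
Qed.

Lemma eq_clique_free (T : finType) (r : nat) (e e' : rel T) :
  e =2 e' -> clique_free r e -> clique_free r e'.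
Proof.
move=> ee ef A /is_cliqueP Ac; apply: ef; apply/is_cliqueP => x y xA yA xy.
by rewrite ee; exact: Ac.
Qed.

Lemma Kr_freeP (T : finType) (r : nat) (E : {set {set T}}) :
  reflect (clique_free r (adjacent E)) (Kr_free r E).
Proof.
apply: (iffP negP) => [h A Ac|h /existsP[A /andP[/eqP Ar Ac]]].
  rewrite ltnNge; apply/negP => /subset_of_card[B BA Br]; apply: h.
  by apply/existsP; exists B; rewrite Br eqxx; exact: sub_clique BA Ac.
by have := h A Ac; rewrite Ar ltnn.
Qed.

Lemma kpartiteP (T : finType) (k : nat) (E : {set {set T}}) :
  reflect (exists f : T -> 'I_k, forall x y, adjacent E x y -> f x != f y)
          (kpartite k E).
Proof.
apply: (iffP existsP) => [[f /forallP h]|[f h]].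
  by exists f => x y; move/forallP: (h x) => /(_ y)/implyP.
exists [ffun x => f x]; apply/forallP => x; apply/forallP => y; apply/implyP.
by rewrite !ffunE; exact: h.
Qed.

Lemma kpartite_clique_free (T : finType) (k : nat) (E : {set {set T}}) :
  kpartite k E -> Kr_free k.+1 E.
Proof.
move=> /kpartiteP[f hf]; apply/Kr_freeP => A /is_cliqueP Ac.
rewrite ltnS -(@card_in_imset _ _ f); first by rewrite -[leqRHS]card_ord max_card.
move=> x y xA yA fxy; apply/eqP/negPn/negP => xy.
by have := hf x y (Ac x y xA yA xy); rewrite fxy eqxx.
Qed.

Lemma cut_le_max_kpartite (T : finType) (k : nat) (E : {set {set T}})
    (f : T -> 'I_k) :
  simple_graph E -> arcs (cut (adjacent E) f) setT <= 2 * max_kpartite k E.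
Proof.
move=> sE; pose H := graph_of (cut (adjacent E) f).
have HE : adjacent H =2 cut (adjacent E) f.
  by apply/adjacent_graph_of/cut_sym/adjacent_sym.
have sH : simple_graph H by apply/graph_of_simple/cut_irr.
rewrite -(eq_arcs (e := adjacent H)) => [|x y _ _]; last exact: HE.
rewrite arcs_adjacent // leq_mul2l /=.
apply: (leq_bigmax_cond (F := fun H : {set {set T}} => #|H|)); apply/andP; split.
  apply/subsetP => e0 /imsetP[[x y]]; rewrite inE /cut /= => /andP[xy _] ->.
  exact: xy.
by apply/kpartiteP; exists f => x y; rewrite HE => /andP[].
Qed.

Lemma max_kpartite_cut (T : finType) (k : nat) (E : {set {set T}}) :
    simple_graph E ->
  exists f : T -> 'I_k.+1,
    2 * max_kpartite k.+1 E <= arcs (cut (adjacent E) f) setT.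
Proof.
move=> sE.
have [|H /andP[HE /kpartiteP[f hf]] EH] := @eq_bigmax_cond _
    [pred H : {set {set T}} | (H \subset E) && kpartite k.+1 H] (fun H => #|H|).
  apply/card_gt0P; exists set0; rewrite inE sub0set; apply/kpartiteP.
  by exists (fun=> ord0) => x y; rewrite /adjacent inE.
exists f; rewrite /max_kpartite EH -arcs_adjacent ?(sub_simple HE) //.
apply: sub_arcs => x y _ _ xy; rewrite /cut (hf _ _ xy) andbT.
exact: (subsetP HE).
Qed.

Lemma max_kpartite_le_max_Kr_free (T : finType) (k : nat) (E : {set {set T}}) :
  max_kpartite k E <= max_Kr_free k.+1 E.
Proof.
apply/bigmax_leqP => H /andP[HE Hk].
apply: (leq_bigmax_cond (F := fun H : {set {set T}} => #|H|)).
by rewrite HE kpartite_clique_free.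
Qed.

Lemma max_Kr_free_witness (T : finType) (r : nat) (E : {set {set T}}) :
    1 < r ->
  exists H : {set {set T}}, [/\ H \subset E, Kr_free r H & #|H| = max_Kr_free r E].
Proof.
move=> r1.
have [|H /andP[HE Hf] EH] := @eq_bigmax_cond _
    [pred H : {set {set T}} | (H \subset E) && Kr_free r H] (fun H => #|H|).
  apply/card_gt0P; exists set0; rewrite inE sub0set.
  case: r r1 => [|[|r]] // _; case: r => [|r]; apply/kpartite_clique_free/kpartiteP;
    by exists (fun=> ord0) => x y; rewrite /adjacent inE.
by exists H; split=> //; rewrite /max_Kr_free EH.
Qed.

Lemma degree_adjacent (T : finType) (E : {set {set T}}) (x : T) :
  degree E x = degree_in (adjacent E) setT x.
Proof.
rewrite /degree -sum1_card /degree_in big_mkcond [RHS]big_mkcond.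
by apply: eq_bigr => y _; rewrite !inE; case: (adjacent _ _ _).
Qed.

Lemma min_degree_le (T : finType) (E : {set {set T}}) (x : T) :
  min_degree E <= degree E x.
Proof.
rewrite /min_degree; have := mem_index_enum x.
elim: (index_enum T) => // y s IH; rewrite inE big_cons => /predU1P[<-|/IH h].
  exact: geq_minl.
exact: leq_trans (geq_minr _ _) h.
Qed.

Lemma le_min_degree (T : finType) (E : {set {set T}}) (d : nat) :
  d <= #|T| -> (forall x, d <= degree E x) -> d <= min_degree E.
Proof.
move=> dT dE; rewrite /min_degree; elim/big_ind: _ => // a b da db.
by rewrite leq_min da.
Qed.

(** * The two bounds *)

Lemma max_kpartite_eq_max_Kr_free (T : finType) (E : {set {set T}}) (q : nat) :
    0 < q -> simple_graph E ->
    (12 * q * q.+1 + 1) * #|T| + 12 * q * q.+1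
      <= 4 * (3 * q + 2) * q * min_degree E + 4 * q.+1 * #|T| ->
  max_kpartite q.+1 E = max_Kr_free q.+2 E.
Proof.
move=> q0 sE dE.
apply/eqP; rewrite eqn_leq max_kpartite_le_max_Kr_free /=.
have [H [HE /Kr_freeP Hf Hm]] := max_Kr_free_witness E (isT : 1 < q.+2).
have sH := sub_simple HE sE.
have [f hf] : exists f : T -> 'I_q.+1,
    arcs (adjacent H) setT <= arcs (cut (adjacent E) f) setT.
  apply: (@coloring_beats_clique_free _ _ _ q (min_degree E)) => //.
  - exact: adjacent_sym.
  - exact: adjacent_irr.
  - exact: adjacent_sym.
  - exact: adjacent_irr.
  - by move=> x y; exact: (subsetP HE).
  - by move=> x; rewrite -degree_adjacent min_degree_le.
  - have [f hf] := greedy_cut q setT (@adjacent_sym T E) (adjacent_irr sE).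
    apply: leq_trans hf _; rewrite leq_mul2l arcs_adjacent // Hm.
    apply: leq_trans (cut_le_max_kpartite f sE) _.
    by rewrite leq_mul2l max_kpartite_le_max_Kr_free.
have := leq_trans hf (cut_le_max_kpartite f sE).
by rewrite arcs_adjacent // leq_mul2l Hm.
Qed.

(** Blow-ups of the weighted graphs of [exists_separating]: replacing v by
    (t + 1) * w v independent copies multiplies all degrees by t + 1, all
    numbers of arcs by (t + 1)^2, and the best cut is still a blow-up. *)
Lemma gap_graphs (q t : nat) :
  exists (T : finType) (E : {set {set T}}),
    [/\ #|T| = t.+1 * (99 + q * 37), simple_graph E,
        t.+1 * (62 + q * 37) <= min_degree E
      & max_kpartite q.+2 E < max_Kr_free q.+3 E].
Proof.
have [V [w [g [h [gs gi hs hg hf gap nn _ tot]]]]] := exists_separating q.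
pose T : finType := {v : V & 'I_(t.+1 * w v)}.
pose p : T -> V := tag.
have fib v : #|[set x : T | p x == v]| = t.+1 * w v.
  have -> : [set x : T | p x == v] = [set Tagged (fun v => 'I_(t.+1 * w v)) i | i : 'I_(t.+1 * w v)].
    apply/setP => -[u i]; rewrite inE /p /=; apply/eqP/imsetP => [uv|[j _]].
      by move: i; rewrite uv => i; exists i.
    by move/(congr1 tag).
  rewrite card_imset ?card_ord // => i j /eqP; by rewrite eq_Tagged => /eqP.
have scale (e : rel V) : arcs (relpre p e) setT = t.+1 ^ 2 * warcs w e.
  by rewrite arcs_relpre (warcs_scale _ fib).
have T_card : #|T| = t.+1 * (99 + q * 37).
  rewrite card_tagged sumnE big_map big_enum /= -tot big_distrr.
  by apply: eq_bigr => v _; rewrite card_ord.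
pose G := graph_of (relpre p g).
have GE : adjacent G =2 relpre p g by apply: adjacent_graph_of => x y; exact: gs.
have sG : simple_graph G by apply: graph_of_simple => x; exact: gi.
exists T, G; split=> //.
  apply: le_min_degree => [|x]; first by rewrite T_card leq_mul2l; apply/orP; right; lia.
  rewrite degree_adjacent (_ : degree_in _ _ _ = t.+1 * \sum_(v | g (p x) v) w v).
    rewrite leq_mul2l; apply/orP; right.
    by have := nn (p x); move: tot; rewrite (bigID (g (p x))) /=; clear; lia.
  rewrite /degree_in big_mkcond /= (partition_big p xpredT) //= big_distrr /= [RHS]big_mkcond.
  apply: eq_bigr => v _.
  rewrite (eq_bigr (fun=> g (p x) v : nat)) => [|y /eqP <-]; last by rewrite inE GE.
  by rewrite sum_nat_const -cardsE fib; case: (g _ _); rewrite ?muln0 ?muln1.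
pose H := graph_of (relpre p h).
have HE : adjacent H =2 relpre p h by apply: adjacent_graph_of => x y; exact: hs.
have hi : irreflexive h by move=> v; apply/negP => /hg; rewrite gi.
have sH : simple_graph H by apply: graph_of_simple => x; exact: hi.
have [f hfc] := max_kpartite_cut q.+1 sG.
rewrite -(ltn_pmul2l (isT : 0 < 2)).
apply: leq_ltn_trans hfc _.
rewrite (eq_arcs (e' := cut (relpre p g) f)); last by move=> x y _ _; rewrite /cut GE.
have [f0 hf0] := cut_relpre_le p f gs gi.
apply: leq_ltn_trans hf0 _; rewrite scale.
apply: leq_trans (_ : t.+1 ^ 2 * warcs w h <= _).
  by rewrite ltn_pmul2l ?expn_gt0 //; exact: gap.
rewrite -scale -(eq_arcs (e := adjacent H)) => [|x y _ _]; last exact: HE.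
rewrite arcs_adjacent // leq_mul2l /=.
apply: (leq_bigmax_cond (F := fun H : {set {set T}} => #|H|)); apply/andP; split.
  apply/subsetP => e0 /imsetP[[x y]]; rewrite inE /= => /hg xy ->.
  by have := GE x y; rewrite /= xy.
apply/Kr_freeP; apply: (eq_clique_free (e := relpre p h)) => [x y|]; first by rewrite HE.
exact: relpre_clique_free.
Qed.

Local Open Scope ring_scope.

(** The excess of c over the threshold absorbs the lower order terms of
    [max_kpartite_eq_max_Kr_free] for large n. *)
Lemma forces_equality_of_gt (R : realType) (q : nat) (c : R) : (0 < q)%N ->
  (4 * (3 * q%:R - 1) * (q%:R + 1) + 1) / (4 * q%:R * (3 * q%:R + 2)) < c ->
  forces_equality q.+2 c.
Proof.
move=> q0 hc.
have q0' : 0 < q%:R :> R by rewrite ltr0n.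
pose K : R := 4 * q%:R * (3 * q%:R + 2).
have K0 : 0 < K by rewrite /K; nra.
pose eps : R := c * K - (4 * (3 * q%:R - 1) * (q%:R + 1) + 1).
have eps0 : 0 < eps by rewrite /eps subr_gt0 -ltr_pdivrMr.
pose B : R := 12 * q%:R * (q%:R + 1) / eps.
exists (Num.bound B) => n nB T E Tn sE dE.
apply: max_kpartite_eq_max_Kr_free => //; rewrite Tn.
have hn : 12 * q%:R * (q%:R + 1) <= eps * n%:R.
  rewrite (mulrC eps) -ler_pdivrMr //; apply: ltW.
  apply: lt_le_trans (archi_boundP _) _; first by rewrite divr_ge0 ?ltW //; nra.
  by rewrite ler_nat.
rewrite -(ler_nat R) !(natrD, natrM, natr1) -?natr1.
have : K * (c * n%:R) <= K * (min_degree E)%:R by rewrite ler_pM2l.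
move: hn; rewrite /eps /K; lra.
Qed.

(** The minimum degree of the graphs of [gap_graphs] is at least
    1 - 37 / (99 + 37 q) times the order, and the order is unbounded. *)
Lemma not_forces_equality_of_le (R : realType) (q : nat) (c : R) :
  c <= (62 + q%:R * 37) / (99 + q%:R * 37) -> ~ forces_equality q.+3 c.
Proof.
move=> hc [n0 h].
have [T [E [Tn sE dE]]] := gap_graphs q n0.
suff -> : max_kpartite q.+2 E = max_Kr_free q.+3 E by rewrite ltnn.
apply: (h #|T|) => //; first by rewrite Tn; lia.
apply: le_trans (_ : ((n0.+1 * (62 + q * 37))%N)%:R <= _); last by rewrite ler_nat.
have q0 : 0 <= q%:R :> R by rewrite ler0n.
rewrite Tn; move: hc; rewrite ler_pdivlMr; last by lra.
rewrite !natrM !natrD !natrM => hc.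
by rewrite mulrCA ler_pM2l ?ltr0n.
Qed.

Theorem theorem1p1 (R : realType) (r : nat) (hr : (4 <= r)%N) :
  (3 * r%:R - 4) / (3 * r%:R - 1) < delta R r /\
  delta R r <= (4 * (3 * r%:R - 7) * (r%:R - 1) + 1)
               / (4 * (r%:R - 2) * (3 * r%:R - 4)).
Proof.
case: r hr => [|[|[|q]]] // hr.
set c0 : R := _ / (4 * _ * _).
set A := [set c : R | forces_equality q.+3 c]%classic.
have q0 : 0 <= q%:R :> R by rewrite ler0n.
have rE : q.+3%:R = q%:R + 3 :> R by rewrite -addn3 natrD.
pose b : R := (62 + q%:R * 37) / (99 + q%:R * 37).
have lbA : lbound A b.
  move=> c Ac; rewrite leNgt; apply/negP => cb.
  exact: (not_forces_equality_of_le (ltW cb) Ac).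
have upA c : c0 < c -> A c.
  move=> hc; apply: forces_equality_of_gt => //; apply: le_lt_trans hc.
  rewrite le_eqVlt; apply/orP; left; apply/eqP; rewrite /c0 rE -natr1.
  by congr (_ / _); ring.
split.
  apply: (@lt_le_trans _ _ b).
    rewrite rE /b ltr_pdivrMr; last by lra.
    by rewrite mulrAC ltr_pdivlMr; [nra|lra].
  apply: lb_le_inf lbA; exists (c0 + 1); apply: upA; lra.
rewrite leNgt; apply/negP => c0d.
pose c := (c0 + delta R q.+3) / 2.
have : delta R q.+3 <= c.
  by apply: ge_inf; [exists b|apply: upA; rewrite /c; lra].
by rewrite /c; lra.
Qed.
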